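(* Let $n\ge2$. If $n$ is a power of $2$, then $$C_n^{\mathrm{lpk}}\left(\frac{4t}{(1+t)^2}\right)=\frac{B_n(t)-(1-t)^n}{n(1+t)^n};$$ otherwise, $$C_n^{\mathrm{lpk}}\left(\frac{4t}{(1+t)^2}\right)=\frac{1}{n(1+t)^n}\sum_{\substack{d\mid n\\ d\text{ odd}}}\mu(d)(1-t)^{n-n/d}B_{n/d}(t).$$
   Context: For a permutation $\pi=\pi(1)\cdots\pi(n)$ of $[n]=\{1,\dots,n\}$, an index $i\in[n-1]$ is a left peak of $\pi$ if either $2\le i\le n-1$ and $\pi(i-1)<\pi(i)>\pi(i+1)$, or $i=1$ and $\pi(1)>\pi(2)$; $\mathrm{lpk}(\pi)$ is the number of left peaks. $\mathfrak{C}_n$ is the set of cyclic permutations of $[n]$ (those consisting of a single cycle of length $n$), and $C_n^{\mathrm{lpk}}(t)=\sum_{\pi\in\mathfrak{C}_n}t^{\mathrm{lpk}(\pi)}$. The type B Eulerian polynomials $B_n(t)$ are defined by $\frac{B_n(t)}{(1-t)^{n+1}}=\sum_{k=0}^\infty(2k+1)^nt^k$. $\mu$ is the number-theoretic Möbius function. *)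

(* Defs.v *)
From mathcomp Require Import all_boot all_order all_algebra all_fingroup.

Set Implicit Arguments.
Unset Strict Implicit.
Unset Printing Implicit Defensive.

Import GRing.Theory.
Local Open Scope ring_scope.

(* A permutation of [n] is an element of 'S_n; positions and values are
   shifted down by one, so the first position is 0. *)

Definition left_peak (n : nat) (s : 'S_n) (i : 'I_n) : bool :=
  [exists j : 'I_n, ((j : nat) == i.+1) && (s j < s i)%N] &&
  (((i : nat) == 0%N) ||
   [exists k : 'I_n, ((i : nat) == k.+1) && (s k < s i)%N]).

Definition lpk (n : nat) (s : 'S_n) : nat := #|[set i | left_peak s i]|.

(* Fixed points count as cycles in porbits, so this says that the cycle
   decomposition is a single cycle through all of 'I_n. *)
Definition cyclic_perm (n : nat) (s : 'S_n) : bool :=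
  porbits s == [set [set: 'I_n]].

Definition cyc_lpk (n : nat) : {poly int} :=
  \sum_(s : 'S_n | cyclic_perm s) 'X^(lpk s).

(* Only meaningful for n > 0. *)
Definition moebius (n : nat) : int :=
  if all (fun p => logn p n == 1%N) (primes n)
  then (-1) ^+ size (primes n) else 0.

(* The product of formal power series given by their coefficient sequences. *)
Definition ps_mul (f g : nat -> int) (N : nat) : int :=
  \sum_(i < N.+1) f i * g (N - i)%N.

(* B = (1 - t)^(n+1) * sum_k (2k+1)^n t^k as formal power series; since 1 - t
   is invertible there, this is the generating function identity
   B / (1 - t)^(n+1) = sum_k (2k+1)^n t^k. *)
Definition is_typeB_eulerian (n : nat) (B : {poly int}) : Prop :=
  forall N : nat,
    B`_N = ps_mul (fun i => ((1 - 'X) ^+ n.+1 : {poly int})`_i)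
                  (fun k => ((2 * k + 1) ^ n)%N%:Z) N.

Lemma is_typeB_eulerian_uniq n B B' :
  is_typeB_eulerian n B -> is_typeB_eulerian n B' -> B = B'.
Proof. by move=> hB hB'; apply/polyP => N; rewrite hB hB'. Qed.

Lemma ps_mulE (p : {poly int}) f N M : (N < M)%N ->
  ps_mul (fun i => p`_i) f N = (p * \poly_(k < M) f k)`_N.
Proof.
move=> ltNM; rewrite coefM; apply: eq_bigr => i _.
by rewrite coef_poly (leq_ltn_trans (leq_subr _ _) ltNM).
Qed.

Lemma size_backward_difference (q : {poly int}) m :
  (size q <= m.+1)%N -> (size (q - (q \Po ('X - 1%:P)))%R <= m)%N.
Proof.
move=> sq; apply/leq_sizeP => j; rewrite leq_eqVlt => /orP[/eqP<-|ltmj].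
  have [lt_m|] := leqP (size q) m.
    by rewrite coefB !nth_default ?subrr // size_comp_poly2 ?size_XsubC.
  move=> gt_m; have sqE : size q = m.+1 by apply/eqP; rewrite eqn_leq sq.
  have sXB : size ('X - 1%:P : {poly int}) = 2 by rewrite size_XsubC.
  have := @lead_coef_comp _ q ('X - 1%:P); rewrite sXB => /(_ isT).
  rewrite lead_coefXsubC expr1n mulr1 !lead_coefE size_comp_poly2 // sqE /=.
  by rewrite coefB => ->; rewrite subrr.
by rewrite coefB !nth_default ?subrr // ?size_comp_poly2 ?size_XsubC //;
   apply: leq_trans ltmj.
Qed.

Lemma ps_mul_poly_seq m (q : {poly int}) : (size q <= m)%N ->
  {B : {poly int} | forall N,
    B`_N = ps_mul (fun i => ((1 - 'X) ^+ m : {poly int})`_i)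
                  (fun k => q.[k%:Z]) N}.
Proof.
elim: m q => [|m IHm] q sq.
  move: sq; rewrite leqn0 size_poly_eq0 => /eqP->; exists 0 => N.
  by rewrite coef0 /ps_mul big1 // => i _; rewrite horner0 mulr0.
set q' := q - (q \Po ('X - 1%:P)).
have [B' hB'] := IHm q' (size_backward_difference sq).
exists (B' + (q \Po ('X - 1%:P)).[0] *: (1 - 'X) ^+ m) => N.
rewrite coefD hB' coefZ !(@ps_mulE _ _ N N.+1) //.
rewrite exprSr -mulrA.
set F' := \poly_(k < N.+1) q'.[_]; set F := \poly_(k < N.+1) q.[_].
have dF k : (k < N.+1)%N ->
    ((1 - 'X) * F)`_k = (F' + (q \Po ('X - 1%:P)).[0]%:P)`_k.
  move=> ltk; rewrite mulrBl mul1r mulrC coefB coefMX coefD coefC !coef_poly ltk.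
  case: k ltk => [|k] ltk /=.
    by rewrite subr0 /q' hornerD hornerN subrK.
  rewrite addr0 (ltn_trans _ ltk) // /q' hornerD hornerN horner_comp.
  by rewrite !hornerE intS addrAC subrr add0r.
transitivity (((1 - 'X) ^+ m * (F' + (q \Po ('X - 1%:P)).[0]%:P))`_N).
  by rewrite mulrDr coefD [_ * _%:P]mulrC mul_polyC coefZ.
rewrite !coefM; apply: eq_bigr => i _.
by rewrite dF // ltnS leq_subr.
Qed.

Lemma typeB_eulerian_ex n : {B : {poly int} | is_typeB_eulerian n B}.
Proof.
have [|B hB] := @ps_mul_poly_seq n.+1 ((2 *: 'X + 1) ^+ n).
  apply: leq_trans (size_poly_exp_leq _ _) _; rewrite ltnS.
  rewrite -[leqRHS]mul1n leq_mul2r -subn1 leq_subLR; apply/orP; right.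
  apply: leq_trans (size_polyD _ _) _; rewrite geq_max size_poly1 andbT.
  by rewrite (leq_trans (size_scale_leq _ _)) // size_polyX.
exists B => N; rewrite hB; apply: eq_bigr => i _; congr (_ * _).
rewrite horner_exp hornerD hornerZ hornerX hornerC.
by rewrite -!natz natrX natrD natrM.
Qed.

(* The unique polynomial with the defining generating function. *)
Definition typeB_eulerian (n : nat) : {poly int} := sval (typeB_eulerian_ex n).

Lemma typeB_eulerianP n : is_typeB_eulerian n (typeB_eulerian n).
Proof. exact: (svalP (typeB_eulerian_ex n)). Qed.

(* The identities are stated in the field Q(t) of rational functions. *)
Notation ratfun := {fraction {poly rat}}.

Definition tvar : ratfun := tofrac 'X.

Definition eval_at (p : {poly int}) (x : ratfun) : ratfun :=
  (map_poly intr p).[x].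

(* Main.v *)
Require Import Defs.
From mathcomp Require Import all_boot all_order all_algebra all_fingroup.
From mathcomp Require Import zify ring.
Set Implicit Arguments.
Unset Strict Implicit.
Unset Printing Implicit Defensive.
Import GRing.Theory.
Local Open Scope ring_scope.

(** Both formulas come from counting one set of pairs in two ways.

    Fix [k] and use the letters [0 .. 2k], an odd letter playing the part of a
    negative number in the alphabet ordered as 0, -1, 1, -2, 2 and so on.  A
    filling of a permutation [s] is a weakly increasing word [f] in which two
    equal neighbours are allowed only at an ascent of [s] if the letter is even
    and only at a descent if it is odd; these are the left enriched P-partitions
    of [s].  Adding the letters of [f] one at a time with a transfer matrix
    shows that the number of fillings depends on [lpk s] only, through
    [sum_k #fillings X^k =
       (4 X)^lpk (1 + X)^(n - 2 lpk) / (1 - X)^(n + 1)]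
    ([is_gf_compatible]): going on in the same direction costs a factor [1 + X],
    and the two turns around a left peak cost [2] and [2 X].

    On the other side, a cyclic [s] is a conjugate of the rotation [p -> p + 1] of
    Z/n in exactly [n] ways.  Reading [f] along the cycle turns a filling of a
    conjugate into a circular word [w], and the conjugating permutation into a
    linear order on the positions of [w] which sorts the rotations of [w] for a
    signed lexicographic order ([compatible_conj]).  This is the
    Gessel-Reutenauer correspondence for a signed alphabet.  A primitive word has
    one such order, the square of a primitive word with an odd number of odd
    letters has two, any other word has none ([card_consistent]).  Moebius
    inversion over the root of the word turns this into a sum over [d | n] of
    [moebius d] times the number of [d]-th powers of words, where for even [d]
    the words are counted with the sign of their root
    ([card_consistent_moebius]).  There are [(2k+1)^(n/d)] such powers, and their
    signed count is [1] since the letters [0 .. 2k] have signs of sum [1].  The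
    even [d] therefore contribute the sum of [moebius d], which is [-1] if [n] is
    a power of two and [0] otherwise ([sum_compatible_cyclic]).

    Comparing the generating functions in [k] gives a polynomial identity
    ([cyclic_lpk_poly]), which is then divided by [n (1 + t)^n]. *)

(** * Sums of the Moebius function over divisors *)

Lemma moebius1 : moebius 1 = 1.
Proof. by []. Qed.

Lemma moebius_mul_dvd p e :
  prime p -> (0 < e)%N -> (p %| e)%N -> moebius (p * e) = 0.
Proof.
move=> p_pr e_gt0 p_e; rewrite /moebius ifF //; apply/negP => /allP/(_ p).
rewrite mem_primes p_pr muln_gt0 prime_gt0 // e_gt0 dvdn_mulr //.
move=> /(_ isT) /=; rewrite lognM ?(prime_gt0 p_pr) // (logn_prime p p_pr) eqxx.
by rewrite add1n eqSS -leqn0 leqNgt logn_gt0 mem_primes p_pr e_gt0 p_e.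
Qed.

Lemma primes_mul_coprime p e : prime p -> (0 < e)%N -> ~~ (p %| e)%N ->
  perm_eq (primes (p * e)) (p :: primes e).
Proof.
move=> p_pr e_gt0 p_e; apply: uniq_perm.
- exact: primes_uniq.
- by rewrite /= primes_uniq andbT mem_primes p_pr e_gt0.
move=> q; rewrite primesM ?(prime_gt0 p_pr) // inE primes_prime // inE.
by [].
Qed.

Lemma moebius_mul_coprime p e : prime p -> (0 < e)%N -> ~~ (p %| e)%N ->
  moebius (p * e) = - moebius e.
Proof.
move=> p_pr e_gt0 p_e; have pq := primes_mul_coprime p_pr e_gt0 p_e.
rewrite /moebius (perm_all _ pq) (perm_size pq) /=.
rewrite lognM ?(prime_gt0 p_pr) // (logn_prime p p_pr) eqxx.
have -> : logn p e = 0%N.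
  by apply/eqP; rewrite -leqn0 leqNgt logn_gt0 mem_primes p_pr e_gt0.
rewrite /= exprS mulN1r.
rewrite (_ : all _ _ = all (fun q => logn q e == 1%N) (primes e)).
  by case: ifP => // _; rewrite oppr0.
apply: eq_in_all => q; rewrite mem_primes => /and3P[q_pr _ q_e].
rewrite lognM ?(prime_gt0 p_pr) // (logn_prime q p_pr).
by case: (q =P p) p_e => [<-|_ _]; [rewrite q_e | rewrite add0n].
Qed.

(** Pair [d] with [p * d]: [moebius] changes sign when a new prime factor
    [p] is added, and vanishes as soon as [p] occurs twice. *)
Lemma sum_moebius_split p m (g : nat -> int) :
  prime p -> (0 < m)%N -> (p %| m)%N ->
  \sum_(d <- divisors m) moebius d * g d =
  \sum_(d <- divisors m | ~~ (p %| d)%N) moebius d * (g d - g (p * d)%N).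
Proof.
move=> p_pr m_gt0 p_m; have p_gt0 := prime_gt0 p_pr.
have mp_gt0 : (0 < m %/ p)%N by rewrite divn_gt0 // dvdn_leq.
under [RHS]eq_bigr => d _ do rewrite mulrBr.
rewrite sumrB (bigID (fun d => p %| d)%N) /= addrC; congr (_ + _).
rewrite -big_filter.
have pm1 : perm_eq [seq d <- divisors m | (p %| d)%N]
                   [seq (p * d)%N | d <- divisors (m %/ p)].
  apply: uniq_perm; first by rewrite filter_uniq // divisors_uniq.
    rewrite map_inj_uniq ?divisors_uniq //.
    by move=> x y /eqP; rewrite eqn_pmul2l // => /eqP.
  move=> d; rewrite mem_filter -dvdn_divisors //; apply/andP/mapP.
    case=> /dvdnP[e ->] em; exists e; last by rewrite mulnC.
    by rewrite -dvdn_divisors // dvdn_divRL.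
  case=> e; rewrite -dvdn_divisors // dvdn_divRL // mulnC => em ->.
  by rewrite dvdn_mulr.
rewrite (perm_big _ pm1) big_map (bigID (fun d => p %| d)%N) /=.
rewrite big1_seq ?add0r; last first.
  move=> d /andP[pd]; rewrite -dvdn_divisors // => /dvdn_gt0-/(_ mp_gt0) d_gt0.
  by rewrite moebius_mul_dvd // mul0r.
rewrite -sumrN -big_filter -[RHS]big_filter.
have pm2 : perm_eq [seq d <- divisors (m %/ p) | ~~ (p %| d)%N]
                   [seq d <- divisors m | ~~ (p %| d)%N].
  apply: uniq_perm; rewrite ?filter_uniq ?divisors_uniq // => d.
  rewrite !mem_filter -!dvdn_divisors // dvdn_divRL //.
  case p_d: (p %| d)%N => //=; rewrite Gauss_dvd ?d_m ?p_m ?andbT //.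
  by rewrite coprime_sym prime_coprime // p_d.
rewrite (perm_big _ pm2) !big_filter big_seq_cond [RHS]big_seq_cond.
apply: eq_bigr => d /andP[]; rewrite -dvdn_divisors // => /dvdn_gt0-/(_ m_gt0) d_gt0 pd.
by rewrite moebius_mul_coprime // mulNr.
Qed.

Lemma sum_moebius m : (0 < m)%N ->
  \sum_(d <- divisors m) moebius d = (m == 1)%N%:R.
Proof.
move=> m_gt0; have [->|m_neq1] := eqVneq m 1%N; first by rewrite big_seq1.
have m_gt1 : (1 < m)%N by rewrite ltn_neqAle eq_sym m_neq1.
have := sum_moebius_split (fun=> 1) (pdiv_prime m_gt1) m_gt0 (pdiv_dvd m).
under eq_bigr do rewrite mulr1; move=> ->.
by rewrite big1 // => d _; rewrite subrr mulr0.
Qed.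

(** The odd divisors of [m] are the divisors of its odd part. *)
Lemma sum_moebius_odd m : (0 < m)%N ->
  \sum_(d <- divisors m | odd d) moebius d = (m`_2^' == 1)%N%:R.
Proof.
move=> m_gt0; rewrite -sum_moebius ?part_gt0 // -big_filter; apply: perm_big.
apply: uniq_perm; rewrite ?filter_uniq ?divisors_uniq // => d.
rewrite mem_filter -!dvdn_divisors ?part_gt0 //.
apply/andP/idP => [[d_odd dm]|dm].
  rewrite -(@part_pnat_id (2%N)^' d) ?partn_dvd //.
  by rewrite -odd_2'nat.
split; last exact: dvdn_trans dm (dvdn_part _ _).
by rewrite odd_2'nat (pnat_dvd dm) // part_pnat.
Qed.

Lemma partn_2'_eq1 n : (0 < n)%N ->
  (n`_2^' == 1)%N <-> exists k : nat, n = (2 ^ k)%N.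
Proof.
move=> n_gt0; split=> [/eqP n2|[k ->]].
  by exists (logn 2 n); rewrite -p_part -[LHS](partnC 2%N n_gt0) n2 muln1.
by rewrite part_p'nat // pnatNK pnatX.
Qed.

Lemma sum_moebius_even n : (1 < n)%N ->
  \sum_(d <- divisors n | ~~ odd d) moebius d = - (n`_2^' == 1)%N%:R.
Proof.
move=> n_gt1; have n_gt0 := ltnW n_gt1.
have := sum_moebius n_gt0; rewrite (gtn_eqF n_gt1) (bigID odd) /=.
by rewrite sum_moebius_odd // => /eqP; rewrite addrC addr_eq0 => /eqP.
Qed.

(** The multiplicity of an [m]-th power of a primitive word, [b] being the parity
    of the number of odd letters of that word.  When [b] holds and [m] is even,
    pairing [d] with [2 * d] leaves only odd [d]: the terms cancel if [4 | m] and
    add up otherwise, which doubles the Moebius sum of [m / 2]. *)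
Lemma sum_moebius_sign m (b : bool) : (0 < m)%N ->
  \sum_(d <- divisors m) moebius d *
     (if odd d then 1 else (-1) ^+ (b && odd (m %/ d))) =
  (if m == 1 then 1 else if (m == 2) && b then 2 else 0)%N%:R.
Proof.
move=> m_gt0; case: b; last first.
  under eq_bigr do rewrite /= expr0 if_same mulr1.
  by rewrite sum_moebius // andbF; case: eqP.
have [m_odd|] := boolP (odd m).
  rewrite big_seq (eq_bigr moebius) -?big_seq; last first.
    move=> d; rewrite -dvdn_divisors // => /dvdn_odd/(_ m_odd)->.
    by rewrite mulr1.
  by rewrite sum_moebius // andbT; case: eqP => // _; case: eqP m_odd => // ->.
rewrite -dvdn2 => m_even; rewrite (sum_moebius_split _ _ _ m_even) //.
have m2_gt0 : (0 < m %/ 2)%N by rewrite divn_gt0 // dvdn_leq.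
have mE : m = (m %/ 2 * 2)%N by rewrite divnK.
rewrite (eq_bigl (fun d => odd d)); last by move=> d; rewrite dvdn2 negbK.
transitivity (\sum_(d <- divisors m | odd d) moebius d *
                 (1 - (-1) ^+ (odd (m %/ 2)))).
  rewrite big_seq_cond [RHS]big_seq_cond; apply: eq_bigr => d /andP[].
  rewrite -dvdn_divisors // => dm d_odd; rewrite d_odd oddM /=.
  congr (_ * (_ - (-1) ^+ nat_of_bool _)).
  have d_gt0 := dvdn_gt0 m_gt0 dm.
  have dm2 : (d %| m %/ 2)%N.
    by rewrite dvdn_divRL // Gauss_dvd ?dm // coprimen2.
  by rewrite divnMA -[in RHS](divnK dm2) oddM d_odd andbT divnAC.
rewrite -mulr_suml sum_moebius_odd //.
have -> : (m == 1)%N = false by case: eqP m_even => // ->.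
rewrite andbT.
case m2_odd: (odd (m %/ 2)); last first.
  by rewrite subrr mulr0; case: eqP m2_odd => // ->.
rewrite (_ : m`_2^' = m %/ 2)%N; last first.
  by rewrite {1}mE partnM // part_pnat_id -?odd_2'nat // part_p'nat // muln1.
rewrite (_ : (m %/ 2 == 1)%N = (m == 2)%N); last by lia.
by case: (m == 2)%N; rewrite ?mul0r.
Qed.

(** * Rational generating functions *)

(** The power series with coefficients [f] is [P / (1 - X) ^ m]; the relation
    of the type B Eulerian polynomials to the odd powers is an instance. *)
Definition is_gf (m : nat) (f : nat -> int) (P : {poly int}) : Prop :=
  forall N : nat, P`_N = ps_mul (fun i => ((1 - 'X) ^+ m : {poly int})`_i) f N.

Lemma is_gfE m f P : is_gf m f P <->
  forall N, P`_N = ((1 - 'X) ^+ m * \poly_(k < N.+1) f k)`_N.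
Proof.
by split=> fP N; rewrite fP (@ps_mulE _ _ N N.+1).
Qed.

Lemma coefM_eq (p q q' : {poly int}) N :
  (forall k, (k <= N)%N -> q`_k = q'`_k) -> (p * q)`_N = (p * q')`_N.
Proof.
by move=> qq'; rewrite !coefM; apply: eq_bigr => i _; rewrite qq' ?leq_subr.
Qed.

Lemma is_gf_uniq m f P Q : is_gf m f P -> is_gf m f Q -> P = Q.
Proof. by move=> fP fQ; apply/polyP => N; rewrite fP fQ. Qed.

Lemma eq_is_gf m f g P : f =1 g -> is_gf m f P -> is_gf m g P.
Proof.
by move=> fg fP N; rewrite fP; apply: eq_bigr => i _; rewrite fg.
Qed.

Lemma is_gf0 m : is_gf m (fun=> 0) 0.
Proof. by move=> N; rewrite coef0 /ps_mul big1 // => i _; rewrite mulr0. Qed.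

Lemma is_gfD m f g P Q :
  is_gf m f P -> is_gf m g Q -> is_gf m (fun k => f k + g k) (P + Q).
Proof.
move=> fP gQ N; rewrite coefD fP gQ -big_split; apply: eq_bigr => i _.
by rewrite mulrDr.
Qed.

Lemma is_gfZ m c f P : is_gf m f P -> is_gf m (fun k => c * f k) (c *: P).
Proof.
move=> fP N; rewrite coefZ fP big_distrr; apply: eq_bigr => i _ /=.
by rewrite mulrCA.
Qed.

Lemma is_gf_sum m (I : eqType) (r : seq I) (D : pred I) f P :
  (forall i, i \in r -> D i -> is_gf m (f i) (P i)) ->
  is_gf m (fun k => \sum_(i <- r | D i) f i k) (\sum_(i <- r | D i) P i).
Proof.
elim: r => [|i r IHr] fP.
  by rewrite big_nil; apply: (eq_is_gf _ (is_gf0 m)) => k; rewrite big_nil.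
have {}IHr := IHr (fun j jr => fP j (@mem_behead _ (i :: r) j jr)).
rewrite big_cons; case: ifP => Di.
  apply: (eq_is_gf _ (is_gfD (fP i (mem_head i r) Di) IHr)) => k.
  by rewrite big_cons Di.
by apply: (eq_is_gf _ IHr) => k; rewrite big_cons Di.
Qed.

(** Partial sums amount to division by [1 - X]. *)
Lemma is_gf_psum m f P :
  is_gf m f P -> is_gf m.+1 (fun k => \sum_(i < k.+1) f i) P.
Proof.
move=> /is_gfE fP; apply/is_gfE => N; rewrite fP exprSr -mulrA.
apply: coefM_eq => k le_kN; rewrite mulrBl mul1r coefB mulrC coefMX !coef_poly.
rewrite ltnS le_kN; case: k le_kN => [|k] le_kN /=.
  by rewrite subr0 big_ord1.
by rewrite ltnS (ltnW le_kN) big_ord_recr /= [_ + f _]addrC addrK.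
Qed.

Lemma is_gf_shift m f P : is_gf m f P ->
  is_gf m (fun k => if k is k'.+1 then f k' else 0) ('X * P).
Proof.
move=> /is_gfE fP; apply/is_gfE => N; rewrite mulrC coefMX.
transitivity (((1 - 'X) ^+ m * (\poly_(k < N) f k) * 'X)`_N); last first.
  rewrite -mulrA; apply: coefM_eq => k le_kN; rewrite coefMX !coef_poly ltnS.
  by rewrite le_kN; case: k le_kN => //= k ->.
by rewrite coefMX; case: N => //= N; rewrite fP.
Qed.

Lemma is_gf_widen m j f P : is_gf m f P -> is_gf (m + j) f ((1 - 'X) ^+ j * P).
Proof.
move=> /is_gfE fP; apply/is_gfE => N; rewrite addnC exprD -mulrA.
apply: coefM_eq => k le_kN; rewrite fP; apply: coefM_eq => i le_ik.
by rewrite !coef_poly !ltnS le_ik (leq_trans le_ik).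
Qed.

Lemma is_gf_const : is_gf 1 (fun=> 1) 1.
Proof.
have fP : is_gf 0 (fun k => if k is 0 then 1 else 0) 1.
  apply/is_gfE => N; rewrite expr0 mul1r coef_poly coefC ltnSn.
  by case: N.
apply: eq_is_gf (is_gf_psum fP) => k.
by rewrite big_ord_recl /= big1 // addr0.
Qed.

(** * Enriched fillings and left peaks *)

(** Two neighbouring letters [x], [y] of a filling, [b] telling whether the
    permutation descends between them; the parity of a letter is its sign. *)
Definition step (b : bool) (x y : nat) : bool :=
  (x < y)%N || (x == y) && (odd x == b).

Fixpoint chain (D : seq bool) (x : nat) (t : seq nat) : bool :=
  match D, t with
  | b :: D', y :: t' => step b x y && chain D' y t'
  | _, _ => true
  end.

(** [a y] counts the fillings of a prefix that end with the letter [y];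
    [transfer] adds one letter. *)
Definition transfer (b : bool) (a : nat -> int) (y : nat) : int :=
  \sum_(x < y.+1) (step b x y)%:R * a x.

Fixpoint transfers (D : seq bool) (a : nat -> int) : nat -> int :=
  if D is b :: D' then transfers D' (transfer b a) else a.

Lemma big_tuple_cons (T : finType) m (F : m.+1.-tuple T -> int) :
  \sum_t F t = \sum_x \sum_(t : m.-tuple T) F (cons_tuple x t).
Proof.
rewrite pair_big /= (reindex (fun p : T * m.-tuple T => cons_tuple p.1 p.2)) //.
exists (fun t => (thead t, behead_tuple t)) => [[x t] _|t _] /=.
  by rewrite theadE; congr (_, _); apply: val_inj.
by rewrite [RHS]tuple_eta; apply: val_inj.
Qed.

Lemma sum_chain M m D (a : nat -> int) : size D = m ->
  \sum_(x < M) a x * \sum_(t : m.-tuple 'I_M) (chain D x (map val t))%:R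
  = \sum_(x < M) transfers D a x.
Proof.
elim: D m a => [|b D IHD] _ a <-.
  apply: eq_bigr => x _ /=; rewrite (eq_bigr (fun=> 1)).
    by rewrite sumr_const card_tuple expn0 mulr1.
  by move=> t _; rewrite /=.
rewrite -[RHS](IHD (size D)) //.
under eq_bigr => x _ do rewrite big_tuple_cons mulr_sumr.
rewrite exchange_big; apply: eq_bigr => y _ /=.
transitivity (\sum_(x < M) (step b x y)%:R * a x *
    \sum_(t : (size D).-tuple 'I_M) (chain D y (map val t))%:R).
  apply: eq_bigr => x _; rewrite -mulrA mulrCA; congr (_ * _).
  rewrite mulr_sumr; apply: eq_bigr => t _.
  by rewrite -natrM mulnb.
rewrite -mulr_suml; congr (_ * _); rewrite /transfer.
rewrite [RHS](big_ord_widen M (fun x => (step b x y)%:R * a x)) //.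
rewrite [RHS]big_mkcond; apply: eq_bigr => x _; rewrite ltnS.
by case: leqP => // lt_yx; rewrite /step ltnNge ltnW // gtn_eqF // mul0r.
Qed.

(** Vectors reached after an ascent ([s = false]) or a descent ([s = true])
    repeat a single sequence [X] on even and odd letters, with a lag of one in
    the second case. *)
Definition lagged (s : bool) (X : nat -> int) (j : nat) : int :=
  if s && ~~ odd j then (if j./2 is i.+1 then X i else 0) else X j./2.

(** The common number of ways to reach the letters [2 i] and [2 i + 1] at an
    ascent, or [2 i + 1] and [2 i + 2] at a descent. *)
Definition even_odd_sum (s : bool) (a : nat -> int) (i : nat) : int :=
  \sum_(x < i.*2.+1 + s) a x.

Lemma transfer_lagged b a : transfer b a =1 lagged b (even_odd_sum b a).
Proof.
have low y : \sum_(x < y) (step b x y)%:R * a x = \sum_(x < y) a x.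
  by apply: eq_bigr => x _; rewrite /step ltn_ord mul1r.
move=> y; rewrite /transfer big_ord_recr /= low /step ltnn eqxx /=.
rewrite /lagged /even_odd_sum; have := odd_double_half y.
case: (odd y) (y./2) => [] i <-; case: b {low} => /=;
  rewrite ?mul0r ?mul1r ?addr0 ?add0n ?add1n ?addn0 ?addn1 ?big_ord_recr //=.
case: i => [|i]; rewrite ?big_ord0 //.
by rewrite addn1.
Qed.

Definition lag_poly (s : bool) : {poly int} := if s then 'X else 1.

(** The factor by which the numerator grows at a step in direction [b] that
    follows a step in direction [s]: [1 + X] if they agree, [2] at
    a left peak, [2 X] at a valley. *)
Definition step_poly (s b : bool) : {poly int} :=
  if b then 1 + lag_poly s else lag_poly s + 'X.

Lemma is_gf_even_odd_sum m s b X P : is_gf m X P ->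
  is_gf m.+1 (even_odd_sum b (lagged s X)) (step_poly s b * P).
Proof.
move=> XP.
have EP : is_gf m (fun i => lagged s X i.*2) (lag_poly s * P).
  rewrite /lagged /lag_poly; case: s.
    apply: eq_is_gf (is_gf_shift XP) => i; rewrite odd_double /=.
    by rewrite doubleK.
  by rewrite mul1r; apply: eq_is_gf XP => i; rewrite doubleK.
have OP : is_gf m (fun i => lagged s X i.*2.+1) P.
  apply: eq_is_gf XP => i; rewrite /lagged /= odd_double andbF uphalf_double.
  by [].
rewrite /step_poly /even_odd_sum; case: b.
  rewrite mulrDl mul1r; apply: eq_is_gf (is_gf_psum (is_gfD OP EP)) => i.
  rewrite addn1; elim: i => [|i IHi].
    by rewrite !big_ord_recr !big_ord0 /=; ring.
  by rewrite big_ord_recr IHi doubleS !big_ord_recr /=; ring.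
rewrite mulrDl; apply: eq_is_gf (is_gf_psum (is_gfD EP (is_gf_shift OP))) => i.
rewrite addn0; elim: i => [|i IHi].
  by rewrite !big_ord_recr !big_ord0 /= addr0.
by rewrite big_ord_recr IHi doubleS !big_ord_recr /=; ring.
Qed.

(** The final factor is that of an ascent: bounding the last letter by [2 k]
    amounts to letting it be followed by the letter [2 k] at an ascent. *)
Fixpoint chain_poly (s : bool) (D : seq bool) : {poly int} :=
  if D is b :: D' then step_poly s b * chain_poly b D' else step_poly s false.

Lemma is_gf_transfers D m s a X P : is_gf m X P -> a =1 lagged s X ->
  is_gf (m + size D).+1 (fun k => \sum_(j < k.*2.+1) transfers D a j)
        (chain_poly s D * P).
Proof.
elim: D m s a X P => [|b D IHD] m s a X P XP aX /=.
  rewrite addn0; apply: eq_is_gf (is_gf_even_odd_sum s false XP) => k.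
  by rewrite /even_odd_sum addn0; apply: eq_bigr => j _; rewrite aX.
rewrite addnS -addSn [_ * chain_poly _ _]mulrC -mulrA.
apply: IHD (is_gf_even_odd_sum s b XP) _ => y.
rewrite transfer_lagged /lagged /even_odd_sum.
have eq_sum n : \sum_(x < n) a x = \sum_(x < n) lagged s X x.
  by apply: eq_bigr => x _; rewrite aX.
by case: ifP => _; [case: y./2 => // i|]; rewrite eq_sum.
Qed.

(** Starting from [s = false], as if an ascent came first, so that a descent at
    the first position counts as a left peak. *)
Fixpoint peaks (s : bool) (D : seq bool) : nat :=
  if D is b :: D' then ((~~ s && b) + peaks b D')%N else 0%N.

Lemma leq_peaks s D : ((peaks s D).*2 + s <= (size D).+1)%N.
Proof.
elim: D s => [|b D IHD] s /=; first by case: s.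
by have := IHD b; case: s; case: b => /=; lia.
Qed.

(** Turns alternate: every left peak is followed by a valley, the last one
    possibly at the final ascent, and together they contribute [2 * 2 X]. *)
Lemma chain_polyE s D : chain_poly s D = (if s then 2 *: 'X else 1) *
  (4 *: 'X) ^+ peaks s D * (1 + 'X) ^+ ((size D).+1 - ((peaks s D).*2 + s)).
Proof.
elim: D s => [|b D IHD] s /=.
  by case: s; rewrite /= ?expr0 ?expr1 ?mul1r ?mulr1 // scaler_nat mulr2n.
have le := leq_peaks b D; rewrite {}IHD /step_poly /lag_poly.
set p := peaks b D in le *; set N := size D in le *.
have two : 2 *: 'X = 'X + 'X :> {poly int} by rewrite scaler_nat mulr2n.
have four : 4 *: 'X = 2 * ('X + 'X) :> {poly int}.
  by rewrite scaler_nat -mulr_natl; ring.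
clearbody p; case: s; case: b le => le /=; rewrite ?add0n ?add1n ?addn0 ?addn1.
- rewrite (_ : N.+2 - (p.*2).+1 = (N.+1 - (p.*2).+1).+1)%N; last by lia.
  by rewrite exprS; ring.
- by rewrite (_ : N.+2 - (p.*2).+1 = N.+1 - p.*2)%N ?two; [ring|lia].
- rewrite (_ : N.+2 - p.+1.*2 = N.+1 - (p.*2).+1)%N; last by lia.
  by rewrite exprS four two; ring.
- rewrite (_ : N.+2 - p.*2 = (N.+1 - p.*2).+1)%N; last by lia.
  by rewrite exprS; ring.
Qed.

Lemma peaks_sum s D : peaks s D =
  (\sum_(i < size D) (~~ nth false (s :: D) i && nth false D i))%N.
Proof.
elim: D s => [|b D IHD] s /=; first by rewrite big_ord0.
by rewrite big_ord_recl /= IHD; congr (_ + _)%N; apply: eq_bigr.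
Qed.

(** * The fillings compatible with a permutation *)

Definition descents n (s : 'S_n.+1) : seq bool :=
  mkseq (fun i => s (inord i.+1) < s (inord i))%N n.

Lemma lpk_peaks n (s : 'S_n.+1) : lpk s = peaks false (descents s).
Proof.
rewrite /lpk -sum1_card peaks_sum size_mkseq big_mkcond big_ord_recr /=.
rewrite [X in (_ + X)%N]ifF ?addn0; last first.
  rewrite inE /left_peak; apply/negP => /andP[/existsP[j /andP[/eqP jE _]] _].
  by have := ltn_ord j; rewrite jE ltnn.
apply: eq_bigr => i _; rewrite inE /left_peak.
have i1 := ltn_ord i.
have wE : widen_ord (leqnSn n) i = inord i.
  by apply: val_inj; rewrite /= inordK // ltnW // ltnS.
have -> : [exists j : 'I_n.+1, ((j : nat) == i.+1) &&
              (s j < s (widen_ord (leqnSn n) i))%N] = nth false (descents s) i.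
  rewrite nth_mkseq // wE; apply/existsP/idP => [[j /andP[/eqP jE]]|lt].
    by have -> : j = inord i.+1 by apply: val_inj; rewrite /= inordK.
  by exists (inord i.+1); rewrite inordK // eqxx.
rewrite andbC wE /=; case: nth; rewrite ?andbF //= !andbT.
rewrite inordK; last by rewrite ltnW // ltnS.
case: i i1 wE => -[|i] /= lt_i _ _ //.
rewrite nth_mkseq; last exact: ltnW.
have ltxx : (s (inord i) != s (inord i.+1)).
  apply/eqP => /perm_inj/(congr1 val)/=; rewrite !inordK; lia.
have -> : [exists k : 'I_n.+1, (i.+1 == k.+1) && (s k < s (inord i.+1))%N] =
   ~~ (s (inord i.+1) < s (inord i))%N.
  rewrite -leqNgt [in RHS]leq_eqVlt (inj_eq val_inj) (negPf ltxx) /=.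
  apply/existsP/idP => [[k /andP[/eqP[iE]]]|lt].
    by rewrite (_ : k = inord i) //; apply: val_inj; rewrite /= inordK // iE.
  exists (inord i); rewrite lt andbT inordK //.
  by rewrite ltnS ltnW // ltnW.
by case: ifP.
Qed.

Definition filling_lt n M (s : 'S_n) (f : {ffun 'I_n -> 'I_M}) (i j : 'I_n) :=
  (f i < f j)%N ||
    (f i == f j :> nat) && (if odd (f i) then s j < s i else s i < s j)%N.

(** All pairs are compared, not only neighbours, so that the relation can be
    transported along any permutation; transitivity of [filling_lt] makes the
    two readings equivalent. *)
Definition compatible n M (s : 'S_n) (f : {ffun 'I_n -> 'I_M}) : bool :=
  [forall i : 'I_n, forall j : 'I_n, (i < j)%N ==> filling_lt s f i j].

Lemma filling_lt_trans n M (s : 'S_n) (f : {ffun 'I_n -> 'I_M}) :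
  transitive (filling_lt s f).
Proof.
move=> j i k; rewrite /filling_lt.
case: (ltngtP (f i) (f j)) => //= [lt_ij _|<-].
  by case/orP=> [/(ltn_trans lt_ij)->//|/andP[/eqP<- _]]; rewrite lt_ij.
case: (ltngtP (f i) (f k)) => //= _.
by case: ifP => _ h1 h2; [exact: ltn_trans h2 h1|exact: ltn_trans h1 h2].
Qed.

Lemma chainP D x (t : seq nat) : size t = size D ->
  reflect (forall i, (i < size D)%N ->
             step (nth false D i) (nth 0%N (x :: t) i) (nth 0%N t i))
          (chain D x t).
Proof.
elim: D x t => [|b D IHD] x [|y t] //=; first by move=> _; constructor.
move=> [st].
apply: (iffP andP) => [[xy /(IHD _ _ st) h] [|i] //= lt_i|h]; first exact: h.
split; first exact: (h 0%N).
by apply/(IHD _ _ st) => i lt_i; apply: (h i.+1).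
Qed.

Lemma compatible_chain n M (s : 'S_n.+1) (t : n.+1.-tuple 'I_M) :
  compatible s [ffun i => tnth t i] =
  chain (descents s) (thead t) (map val (behead t)).
Proof.
have tE : map val t = (thead t : nat) :: map val (behead t).
  by case/tupleP: (t) => x u; rewrite theadE.
set f := [ffun i => _].
transitivity (sorted (filling_lt s f) (enum 'I_n.+1)).
  rewrite (sorted_pairwise (@filling_lt_trans _ _ s f)).
  apply/forallP/idP => [h|].
    apply/(pairwiseP ord0) => i j; rewrite !inE size_enum_ord => li lj lt_ij.
    have /forallP/(_ (nth ord0 (enum 'I_n.+1) j))/implyP :=
      h (nth ord0 (enum 'I_n.+1) i).
    by rewrite !nth_enum_ord //; apply.
  move=> /(pairwiseP ord0) h i; apply/forallP => j; apply/implyP => lt_ij.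
  have := h i j; rewrite !inE size_enum_ord !ltn_ord => /(_ isT isT lt_ij).
  by rewrite !nth_ord_enum.
have sz : size (map val (behead t)) = size (descents s).
  by rewrite size_map size_behead size_tuple size_mkseq.
have nthE i : (i < n.+1)%N ->
    nth 0%N ((thead t : nat) :: map val (behead t)) i = f (inord i).
  move=> lt_i; rewrite ffunE (tnth_nth (thead t)) inordK //.
  rewrite -(nth_map (thead t) 0%N (fun x : 'I_M => (x : nat))) ?size_tuple //.
  by rewrite -tE.
have stepE j : (j < n)%N ->
   filling_lt s f (inord j) (inord j.+1) =
   step (nth false (descents s) j) (nth 0%N ((thead t : nat) :: map val (behead t)) j)
        (nth 0%N (map val (behead t)) j).
  move=> lt_i; rewrite nthE 1?ltnW //; have := nthE j.+1 lt_i => /= ->.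
  rewrite /filling_lt /step nth_mkseq //; congr (_ || _ && _).
  have : s (inord j) != s (inord j.+1) :> nat.
    rewrite (inj_eq val_inj) (inj_eq perm_inj) -(inj_eq val_inj) /= !inordK //.
      by rewrite neq_ltn ltnSn.
    exact: ltnW.
  by case: odd; case: ltngtP.
apply/(sortedP ord0)/(chainP _ sz) => h i; rewrite ?size_mkseq => lt_i.
  rewrite -stepE //; have := h i; rewrite size_enum_ord ltnS => /(_ lt_i).
  congr (filling_lt _ _ _ _); apply: val_inj; rewrite /= nth_enum_ord ?inordK //;
    exact: ltnW.
move: lt_i; rewrite size_enum_ord ltnS => lt_i.
have := h i; rewrite size_mkseq -stepE // => /(_ lt_i).
  congr (filling_lt _ _ _ _); apply: val_inj; rewrite /= nth_enum_ord ?inordK //;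
    exact: ltnW.
Qed.

(** The first factor starts from a virtual ascent, where every letter ends
    exactly one filling of length one: its generating function is [1 / (1 - X)]. *)
Lemma is_gf_compatible n (s : 'S_n.+1) :
  is_gf n.+2 (fun k => #|[set f : {ffun 'I_n.+1 -> 'I_(k.*2.+1)} | compatible s f]|%:Z)
        ((4 *: 'X) ^+ lpk s * (1 + 'X) ^+ (n.+1 - (lpk s).*2)).
Proof.
have := @is_gf_transfers (descents s) 1 false (fun=> 1) (fun=> 1) 1 is_gf_const.
move=> /(_ (fun _ => erefl)); rewrite size_mkseq add1n mulr1 chain_polyE mul1r.
rewrite -lpk_peaks addn0 size_mkseq; apply: eq_is_gf => k.
rewrite -(@sum_chain _ n) ?size_mkseq //.
symmetry; rewrite -sum1_card -natz natr_sum.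
rewrite (reindex (fun t : n.+1.-tuple 'I_(k.*2.+1) => [ffun i => tnth t i])).
  rewrite big_mkcond big_tuple_cons; apply: eq_bigr => x _; rewrite mul1r.
  apply: eq_bigr => t _; rewrite inE compatible_chain theadE /=.
  by case: chain.
exists (fun f : {ffun _} => [tuple f i | i < n.+1]) => [t _|f _].
  by apply: eq_from_tnth => i; rewrite tnth_mktuple ffunE.
by apply/ffunP => i; rewrite ffunE tnth_mktuple.
Qed.

(** * Cyclic permutations as conjugates of a rotation *)

Definition rotation n : 'S_n.+2 := perm (@addIr _ (1 : 'I_n.+2)).

Lemma cyclic_permP n (s : 'S_n.+1) :
  reflect (forall x, porbit s x = setT) (cyclic_perm s).
Proof.
apply: (iffP eqP) => [sT x|sT].
  by apply/set1P; rewrite -sT; apply: imset_f.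
apply/setP => A; rewrite inE; apply/imsetP/eqP => [[x _ ->]|->] //.
by exists ord0.
Qed.

Lemma conj_rotation_iter n (s : 'S_n.+2) k :
  s k%:R = iter k (rotation n ^ s)%g (s 0).
Proof.
elim: k => [|k IHk] //; rewrite iterS -IHk permJ permE.
by rewrite -natr1.
Qed.

Lemma conj_rotation_cyclic n (s : 'S_n.+2) : cyclic_perm (rotation n ^ s)%g.
Proof.
have h0 y : y \in porbit (rotation n ^ s)%g (s 0).
  rewrite -(permKV s y) -[(s^-1)%g y]natr_Zp conj_rotation_iter -permX.
  exact: mem_porbit.
apply/cyclic_permP => x; apply/setP => y; rewrite inE.
by have := h0 x; rewrite -eq_porbit_mem => /eqP ->; rewrite h0.
Qed.

(** A conjugating permutation is determined by the image of [0], which can be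
    chosen freely because [u] has a single cycle. *)
Lemma card_conj_rotation n (u : 'S_n.+2) : cyclic_perm u ->
  #|[set s | (rotation n ^ s == u)%g]| = n.+2.
Proof.
move=> /cyclic_permP uT.
have ou x : #|porbit u x| = n.+2 by rewrite uT cardsT card_ord.
rewrite -[RHS]card_ord -(card_in_imset (f := fun s : 'S_n.+2 => s 0)); last first.
  move=> s t; rewrite !inE => /eqP su /eqP tu st; apply/permP => x.
  by rewrite -[x]natr_Zp !conj_rotation_iter su tu st.
apply: eq_card => x; rewrite [RHS]inE; apply/imsetP.
have inj_iter : injective (fun p : 'I_n.+2 => iter p u x).
  move=> p q pq; apply: val_inj; apply/eqP.
  have := uniq_traject_porbit u x; rewrite ou => uniq_u.
  rewrite -(nth_uniq x _ _ uniq_u) ?size_traject ?ltn_ord //.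
  by rewrite !nth_traject ?ltn_ord //; apply/eqP.
exists (perm inj_iter); last by rewrite permE.
rewrite inE; apply/eqP/permP => y; rewrite -[y](permKV (perm inj_iter)).
set p := ((perm inj_iter)^-1)%g y; rewrite permJ !permE -iterS.
have valE : (p + 1 : 'I_n.+2) = (p.+1 %% n.+2)%N :> nat.
  by rewrite /= modnDmr addn1.
have [p1|p1] := ltnP p.+1 n.+2; first by rewrite valE modn_small.
have pE : p.+1 = n.+2 by apply/eqP; rewrite eqn_leq p1 (ltn_ord p).
by have := iter_porbit u x; rewrite ou valE pE modnn.
Qed.

Lemma sum_conj_rotation n (F : 'S_n.+2 -> nat) :
  (\sum_s F (rotation n ^ s)%g = n.+2 * \sum_(u | cyclic_perm u) F u)%N.
Proof.
rewrite (partition_big (fun s => rotation n ^ s)%g (@cyclic_perm n.+2)) /=.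
  rewrite big_distrr /=; apply: eq_bigr => u u_cyc.
  rewrite (eq_bigr (fun=> F u)) => [|s /eqP-> //].
  by rewrite sum_nat_const -cardsE (card_conj_rotation u_cyc).
by move=> s _; apply: conj_rotation_cyclic.
Qed.

(** * Orders on the rotations of a circular word *)

Definition strict_total (T : eqType) (r : rel T) : Prop :=
  [/\ irreflexive r, transitive r & forall p q, p != q -> r p q || r q p].

Lemma strict_total_asym (T : eqType) (r : rel T) p q :
  strict_total r -> p != q -> r q p = ~~ r p q.
Proof.
move=> [irr tr tot] /tot; case rpq: (r p q) => /=; last by move=> ->.
by move=> _; apply/negP => /(tr _ _ _ rpq); rewrite irr.
Qed.

Lemma strict_total_eq (T : eqType) (r r' : rel T) :
  strict_total r -> strict_total r' -> subrel r r' -> r =2 r'.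
Proof.
move=> rT r'T sub p q; apply/idP/idP => [/sub //|r'pq].
have [eq_pq|neq_pq] := eqVneq p q; first by move: r'pq; rewrite eq_pq; case: r'T => ->.
have [_ _ tot] := rT; case/orP: (tot _ _ neq_pq) => // /sub.
by rewrite (strict_total_asym r'T neq_pq) r'pq.
Qed.

Lemma strict_total_inj (T : eqType) (k : T -> nat) :
  injective k -> strict_total (fun p q => k p < k q)%N.
Proof.
move=> k_inj; split=> [p|q p s|p q]; [exact: ltnn|exact: ltn_trans|].
by rewrite -neq_ltn (inj_eq k_inj).
Qed.

Definition perm_lt n (s : 'S_n) : rel 'I_n := fun p q => (s p < s q)%N.

Lemma perm_lt_total n (s : 'S_n) : strict_total (perm_lt s).
Proof. by apply: strict_total_inj => p q /val_inj/perm_inj. Qed.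

(** The value of a permutation at [p] is the rank of [p] in its order. *)
Lemma perm_lt_inj n (s t : 'S_n) : perm_lt s =2 perm_lt t -> s = t.
Proof.
move=> st; have rank (u : 'S_n) p : (u p : nat) = #|[set x | perm_lt u x p]|.
  rewrite -(card_imset _ (@perm_inj _ u)) (_ : _ @: _ = [set y : 'I_n | (y < u p)%N]).
    rewrite cardsE -sum1_card (eq_bigl (fun y : 'I_n => (y < u p)%N)) //.
    rewrite -(big_ord_widen n (fun=> 1%N)) ?(ltnW (ltn_ord _)) //.
    by rewrite sum1_card card_ord.
  apply/setP => y; rewrite inE; apply/imsetP/idP => [[x]|lt_y].
    by rewrite inE => ? ->.
  by exists (u^-1 y)%g; rewrite ?permKV // inE /perm_lt permKV.
apply/permP => p; apply: val_inj; rewrite /= !rank.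
by apply: eq_card => x; rewrite !inE st.
Qed.

Lemma strict_total_perm n (r : rel 'I_n) : strict_total r ->
  exists s : 'S_n, perm_lt s =2 r.
Proof.
move=> rT; have [irr tr tot] := rT.
have rank_lt p : (#|[set x | r x p]| < n)%N.
  have := card_ord n; rewrite -cardsT => cardT; rewrite -[X in (_ < X)%N]cardT.
  apply: proper_card; rewrite properT.
  by apply/negP => /eqP/setP/(_ p); rewrite !inE irr.
pose rank p := Ordinal (rank_lt p).
have rank_mono p q : r p q -> (rank p < rank q)%N.
  move=> rpq; apply: proper_card; apply/properP; split.
    by apply/subsetP => x; rewrite !inE => /tr; apply.
  by exists p; rewrite !inE ?irr.
have rank_inj : injective rank.
  move=> p q eq_pq; apply/eqP/contraT => /tot/orP[] /rank_mono;
    by rewrite eq_pq ltnn.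
exists (perm rank_inj) => p q; symmetry.
apply: (strict_total_eq rT (perm_lt_total _)) => {p q} p q /rank_mono.
by rewrite /perm_lt !permE.
Qed.

(** The signed lexicographic comparison of the rotations of [w], given a
    comparison [r] of their tails: an odd letter reverses what follows it. *)
Definition lift_rel n (w : 'I_n.+2 -> nat) (r : rel 'I_n.+2) : rel 'I_n.+2 :=
  fun p q => (w p < w q)%N ||
    (w p == w q) && (if odd (w p) then r (q + 1) (p + 1) else r (p + 1) (q + 1)).

(** [s] ranks the positions of [w]; the order of two rotations must agree with
    their first letters and, these being equal, with the order of the tails. *)
Definition consistent n (w : 'I_n.+2 -> nat) (s : 'S_n.+2) : bool :=
  [forall p, forall q, perm_lt s p q == lift_rel w (perm_lt s) p q].

Lemma consistentP n (w : 'I_n.+2 -> nat) (s : 'S_n.+2) :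
  reflect (perm_lt s =2 lift_rel w (perm_lt s)) (consistent w s).
Proof.
apply: (iffP forallP) => [h p q|h p]; last by apply/forallP => q; rewrite -h.
by have /forallP/(_ q)/eqP := h p.
Qed.

Lemma lift_rel_total n (w : 'I_n.+2 -> nat) r :
  strict_total r -> strict_total (lift_rel w r).
Proof.
move=> [irr tr tot]; split=> [p|q p s|p q]; rewrite /lift_rel.
- by rewrite ltnn eqxx irr if_same.
- case: (ltngtP (w p) (w q)) => //= [lt_pq _|<-].
    by case/orP=> [/(ltn_trans lt_pq)->//|/andP[/eqP<- _]]; rewrite lt_pq.
  case: (ltngtP (w p) (w s)) => //= _.
  by case: ifP => _ h1 h2; [exact: tr h2 h1|exact: tr h1 h2].
- move=> neq_pq; case: (ltngtP (w p) (w q)) => //= ->.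
  rewrite -(inj_eq (@addIr _ 1)) in neq_pq.
  by case: ifP => _; apply: tot; rewrite // eq_sym.
Qed.

Lemma lift_rel_neq n (w : 'I_n.+2 -> nat) r p q : strict_total r -> p != q ->
  w p = w q -> lift_rel w r p q = odd (w p) (+) r (p + 1) (q + 1).
Proof.
move=> rT neq_pq eq_w; rewrite /lift_rel eq_w ltnn eqxx /=; case: odd => //=.
by apply: strict_total_asym => //; rewrite (inj_eq (@addIr _ 1)).
Qed.

Fixpoint parity n (w : 'I_n.+2 -> nat) (p : 'I_n.+2) (j : nat) : bool :=
  if j is j'.+1 then odd (w p) (+) parity w (p + 1) j' else false.

Lemma parityD n (w : 'I_n.+2 -> nat) p i j :
  parity w p (i + j) = parity w p i (+) parity w (p + i%:R) j.
Proof.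
elim: i p => [|i IHi] p /=; first by rewrite addr0.
by rewrite IHi addbA -addrA nat1r.
Qed.

(** * Counting the consistent orders of a word *)

Lemma eq_addr1 n (p q : 'I_n.+2) : (p + 1 == q + 1) = (p == q).
Proof. exact: (inj_eq (@addIr _ 1)). Qed.

(** The rotations of [w] at [p] and [q] are equal words. *)
Definition tied n (w : 'I_n.+2 -> nat) (p q : 'I_n.+2) : Prop :=
  forall j : nat, w (p + j%:R) = w (q + j%:R).

Lemma tied_sym n (w : 'I_n.+2 -> nat) p q : tied w p q -> tied w q p.
Proof. by move=> t j; rewrite t. Qed.

Lemma tied_shift n (w : 'I_n.+2 -> nat) p q i :
  tied w p q -> tied w (p + i%:R) (q + i%:R).
Proof. by move=> t j; rewrite -!addrA -natrD t. Qed.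

Lemma tied0 n (w : 'I_n.+2 -> nat) p q : tied w p q -> w p = w q.
Proof. by move/(_ 0%N); rewrite !addr0. Qed.

Lemma consistent_step n (w : 'I_n.+2 -> nat) s p q :
  consistent w s -> p != q -> w p = w q ->
  perm_lt s p q = odd (w p) (+) perm_lt s (p + 1) (q + 1).
Proof.
move=> /consistentP cs neq_pq eq_w; rewrite cs lift_rel_neq //.
exact: perm_lt_total.
Qed.

Lemma consistent_iter n (w : 'I_n.+2 -> nat) s p q j :
  consistent w s -> p != q -> tied w p q ->
  perm_lt s p q = parity w p j (+) perm_lt s (p + j%:R) (q + j%:R).
Proof.
move=> cs; elim: j p q => [|j IHj] p q neq_pq t; first by rewrite !addr0.
rewrite (consistent_step cs neq_pq (tied0 t)) /= (IHj (p + 1) (q + 1)).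
- by rewrite -!addrA !nat1r addbA.
- by rewrite eq_addr1.
- exact: (tied_shift 1 t).
Qed.

(** Two consistent orders that disagree on a pair have equal letters there and
    disagree on the next pair too, hence on a tied pair. *)
Lemma consistent_uniq n (w : 'I_n.+2 -> nat) s t :
  consistent w s -> consistent w t ->
  (forall p q, p != q -> tied w p q -> perm_lt s p q = perm_lt t p q) -> s = t.
Proof.
move=> cs ct st; apply: perm_lt_inj => p q.
have [->|neq_pq] := eqVneq p q; first by rewrite /perm_lt !ltnn.
case: (eqVneq (perm_lt s p q) (perm_lt t p q)) => // neq_st.
have diff j : w (p + j%:R) = w (q + j%:R) /\
   perm_lt s (p + j%:R) (q + j%:R) != perm_lt t (p + j%:R) (q + j%:R).
  have neq_w x y : perm_lt s x y != perm_lt t x y -> w x = w y.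
    have /consistentP-> := cs; have /consistentP-> := ct.
    by rewrite /lift_rel; case: (ltngtP (w x) (w y)).
  elim: j => [|j [eq_w neq]]; first by rewrite !addr0; split=> //; apply: neq_w.
  rewrite -natr1 !addrA.
  set x := p + _ in eq_w neq *; set y := q + _ in eq_w neq *.
  have neq_xy : x != y by rewrite (inj_eq (@addIr 'I_n.+2 _)).
  have neq1 : perm_lt s (x + 1) (y + 1) != perm_lt t (x + 1) (y + 1).
    move: neq; rewrite (consistent_step cs) // (consistent_step ct) //.
    by apply: contraNN => /eqP->.
  by split=> //; apply: neq_w.
by apply: st => // j; case: (diff j).
Qed.

(** Iterating the signed comparison from an order [r] that is already stable on
    tied positions reaches a fixed point: at the other pairs the outcome is
    decided before the tails are ever compared by [r]. *)
Lemma consistent_exists n (w : 'I_n.+2 -> nat) r :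
  strict_total r -> (forall p q, tied w p q -> r p q = lift_rel w r p q) ->
  exists2 s, consistent w s & forall p q, tied w p q -> perm_lt s p q = r p q.
Proof.
move=> rT r_fix; pose R j := iter j (lift_rel w) r.
have RT j : strict_total (R j) by elim: j => //= j; apply: lift_rel_total.
have [s sR] := strict_total_perm (RT n.+2).
have R_tied j p q : tied w p q -> R j p q = r p q.
  elim: j p q => // j IHj p q t; rewrite [RHS]r_fix //= /lift_rel.
  rewrite !IHj //; first exact: (tied_shift 1 t).
  exact: (tied_sym (tied_shift 1 t)).
exists s => [|p q t]; last by rewrite sR R_tied.
(* Either the letters decide within [j] steps, and then [r] is not consulted, or
   the comparison descends to a pair where [r] is stable. *)
have R_stable j p q :
    ((forall i, (i < j)%N -> w (p + i%:R) = w (q + i%:R)) ->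
       tied w (p + j%:R) (q + j%:R)) -> R j.+1 p q = R j p q.
  elim: j p q => [|j IHj] p q t.
    by rewrite [RHS]r_fix //; move: t; rewrite !addr0; apply.
  rewrite [LHS]/= [RHS]/= /lift_rel -/(R j.+1) -/(R j).
  case: ltngtP => //= eq_w.
  have t' : (forall i, (i < j)%N -> w (p + 1 + i%:R) = w (q + 1 + i%:R)) ->
       tied w (p + 1 + j%:R) (q + 1 + j%:R).
    move=> h; rewrite -!addrA !nat1r; apply: t => -[|i] lt_i.
      by rewrite !addr0.
    by have := h i lt_i; rewrite -!addrA !nat1r.
  by case: ifP => _; apply: IHj => // h; apply: tied_sym; apply: t' => i /h.
apply/consistentP => p q; rewrite sR; transitivity (R n.+3 p q); last first.
  by rewrite /R [LHS]/= /lift_rel !sR.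
symmetry; apply: R_stable => eq_w; apply: tied_shift => j.
rewrite -[j%:R]natr_Zp; apply: eq_w; exact: ltn_ord.
Qed.

Definition period n (w : 'I_n.+2 -> nat) (e : nat) : bool :=
  [forall p, w (p + e%:R) == w p].

Lemma periodP n (w : 'I_n.+2 -> nat) e :
  reflect (forall p, w (p + e%:R) = w p) (period w e).
Proof. by apply: (iffP forallP) => h p; apply/eqP. Qed.

Lemma natr_ord n (e : nat) : (e%:R : 'I_n.+2) = (e %% n.+2)%N :> nat.
Proof. by rewrite Zp_nat. Qed.

Lemma natr_ord_eq0 n (e : nat) : ((e%:R : 'I_n.+2) == 0) = (n.+2 %| e)%N.
Proof. by rewrite -(inj_eq val_inj) /= natr_ord. Qed.

Lemma period_size n (w : 'I_n.+2 -> nat) : period w n.+2.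
Proof.
apply/periodP => p; rewrite (_ : n.+2%:R = 0) ?addr0 //.
by apply/eqP; rewrite natr_ord_eq0.
Qed.

Lemma period_mul n (w : 'I_n.+2 -> nat) e k : period w e -> period w (k * e).
Proof.
move=> /periodP we; elim: k => [|k /periodP IHk].
  by apply/periodP => p; rewrite addr0.
by apply/periodP => p; rewrite mulSn natrD addrA IHk we.
Qed.

Lemma least_period_ex n (w : 'I_n.+2 -> nat) : exists e, (0 < e)%N && period w e.
Proof. by exists n.+2; rewrite period_size. Qed.

Definition least_period n (w : 'I_n.+2 -> nat) : nat :=
  ex_minn (least_period_ex w).

Lemma least_period_gt0 n (w : 'I_n.+2 -> nat) : (0 < least_period w)%N.
Proof. by rewrite /least_period; case: ex_minnP => e /andP[]. Qed.

Lemma periodE n (w : 'I_n.+2 -> nat) e : period w e = (least_period w %| e)%N.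
Proof.
have l_gt0 := least_period_gt0 w; move: l_gt0.
rewrite /least_period; case: ex_minnP => l /andP[_ wl] l_min l_gt0.
apply/idP/idP => [we|/dvdnP[k ->]]; last exact: period_mul.
apply/contraT; rewrite /dvdn -lt0n => r_gt0.
have := l_min (e %% l)%N; rewrite r_gt0 leqNgt ltn_mod l_gt0; apply.
apply/periodP => p; rewrite -(periodP _ _ (period_mul (e %/ l) wl)).
by rewrite -addrA -natrD addnC -divn_eq (periodP _ _ we).
Qed.

Lemma least_period_dvd n (w : 'I_n.+2 -> nat) : (least_period w %| n.+2)%N.
Proof. by rewrite -periodE period_size. Qed.

Lemma parity_shift n (w : 'I_n.+2 -> nat) e p j :
  period w e -> parity w (p + e%:R) j = parity w p j.
Proof.
move=> /periodP we; elim: j p => //= j IHj p.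
by rewrite we addrAC IHj.
Qed.

Lemma parity_rot n (w : 'I_n.+2 -> nat) e (p : nat) :
  period w e -> parity w p%:R e = parity w 0 e.
Proof.
move=> we; have := parityD w 0 p e; rewrite addnC parityD !add0r.
rewrite -[in parity w e%:R p](add0r e%:R) parity_shift // addbC.
by move/addbI.
Qed.

Lemma parity_mul n (w : 'I_n.+2 -> nat) e k :
  period w e -> parity w 0 (k * e) = parity w 0 e && odd k.
Proof.
move=> we; elim: k => [|k IHk]; first by rewrite andbF.
rewrite mulSn addnC parityD IHk add0r parity_rot //= [RHS]andbC.
by case: odd; case: parity.
Qed.

Lemma tied_leq n (w : 'I_n.+2 -> nat) (p q : 'I_n.+2) :
  tied w p q -> (p <= q)%N -> period w (q - p)%N.
Proof.
move=> t le_pq; apply/periodP => x.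
have eq_x (y : 'I_n.+2) : y + (nat_of_ord (x - y)%R)%:R = x.
  by rewrite natr_Zp addrC subrK.
rewrite -{2}(eq_x p) t natrB // !natr_Zp; congr (w _).
ring.
Qed.

Lemma tied_mod n (w : 'I_n.+2 -> nat) (p q : 'I_n.+2) :
  tied w p q -> p = q %[mod least_period w].
Proof.
move=> t; case/orP: (leq_total p q) => le.
  by apply/esym/eqP; rewrite eqn_mod_dvd // -periodE tied_leq.
by apply/eqP; rewrite eqn_mod_dvd // -periodE tied_leq //; apply: tied_sym.
Qed.

(** A period that preserved a consistent order would have an endlessly ascending
    or descending orbit on the circle, so it reverses the order. *)
Lemma consistent_period n (w : 'I_n.+2 -> nat) s e :
  consistent w s -> period w e -> ~~ (n.+2 %| e)%N -> parity w 0 e.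
Proof.
move=> cs we ne; apply/contraT => even_e.
have neq (p : 'I_n.+2) : p != p + e%:R.
  by rewrite -subr_eq0 opprD addNKr oppr_eq0 natr_ord_eq0.
have t p : tied w p (p + e%:R).
  by move=> j; rewrite addrAC (periodP _ _ we).
have lt_const k : perm_lt s (k * e)%:R (k.+1 * e)%:R = perm_lt s 0 e%:R.
  elim: k => [|k <-]; first by rewrite mul1n.
  have nextE i : (i.+1 * e)%:R = (i * e)%:R + e%:R :> 'I_n.+2.
    by rewrite mulSn addnC natrD.
  rewrite [in RHS]nextE (consistent_iter e cs (neq _) (t _)) parity_rot //.
  by rewrite (negPf even_e) /= -!nextE.
(* The multiples of [e] come back to [0] after [n.+2] steps. *)
have absurd (r : 'I_n.+2 -> nat) :
    (forall k, (r (k * e)%:R < r (k.+1 * e)%:R)%N) -> False.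
  move=> r_lt; have r_ge k : (r 0%R + k <= r (k * e)%:R)%N.
    elim: k => [|k IHk]; first by rewrite addn0.
    by rewrite addnS (leq_ltn_trans IHk).
  have := r_ge n.+2; have /eqP-> : ((n.+2 * e)%:R : 'I_n.+2) == 0.
    by rewrite natr_ord_eq0 dvdn_mulr.
  by rewrite -[X in (_ <= X)%N]addn0 leq_add2l.
case lt0: (perm_lt s 0 e%:R).
  by case: (absurd (fun x => s x)) => k; have := lt_const k; rewrite lt0.
case: (absurd (fun x => n.+2 - s x)%N) => k.
suff: perm_lt s (k.+1 * e)%:R (k * e)%:R.
  by rewrite /perm_lt => lt; apply: ltn_sub2l => //; apply: ltn_trans (ltn_ord _).
rewrite (strict_total_asym (perm_lt_total s) (_ : (k * e)%:R != _)).
  by rewrite lt_const lt0.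
by rewrite mulSn addnC natrD neq.
Qed.

(** A double shift has even parity, so it cannot reverse the order. *)
Lemma consistent_square n (w : 'I_n.+2 -> nat) s e :
  consistent w s -> period w e -> (n.+2 %| 2 * e)%N.
Proof.
move=> cs we; apply/contraT => ne.
by have := consistent_period cs (period_mul 2 we) ne; rewrite parity_mul // andbF.
Qed.

(** Consistent orders of the square of a word of odd parity: they agree except on
    the pairs at distance [h], and are told apart by a single such pair. *)
Lemma card_consistent_square n (w : 'I_n.+2 -> nat) h :
  n.+2 = (2 * h)%N -> least_period w = h -> parity w 0 h ->
  #|[set s | consistent w s]| = 2%N.
Proof.
move=> nE lE odd_h; have h_gt0 : (0 < h)%N by rewrite -lE least_period_gt0.
have wh : period w h by rewrite periodE lE.
have h_lt : (h < n.+2)%N by rewrite nE; lia.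
have distinct (p q : 'I_n.+2) :
    p = q %[mod h] -> p != q -> q = p + h%:R \/ p = q + h%:R.
  move=> eq_mod neq_pq.
  have {}neq_pq : (p : nat) != q by rewrite (inj_eq val_inj).
  have next (x y : 'I_n.+2) : y = (x + h)%N :> nat -> y = x + h%:R.
    by move=> yE; rewrite -[y]natr_Zp yE natrD natr_Zp.
  have := ltn_ord p; have := ltn_ord q.
  rewrite [X in (q < X)%N]nE [X in (p < X)%N]nE => ltq ltp.
  case: (ltngtP p q) neq_pq => // lt _; [left|right]; apply: next.
    have : (h %| q - p)%N by rewrite -eqn_mod_dvd ?(ltnW lt) // eq_mod.
    by case/dvdnP => -[|[|k]] kE; nia.
  have : (h %| p - q)%N by rewrite -eqn_mod_dvd ?(ltnW lt) // eq_mod.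
  by case/dvdnP => -[|[|k]] kE; nia.
have neq0h : 0 != h%:R :> 'I_n.+2.
  by rewrite eq_sym natr_ord_eq0 gtnNdvd.
have tied_h p : tied w p (p + h%:R).
  by move=> j; rewrite addrAC (periodP _ _ wh).
(* A bit that changes exactly at the odd letters.  It is well defined around the
   circle because the whole word has even parity, and differs at two positions
   at distance [h] because its root has odd parity. *)
pose bit b (p : 'I_n.+2) := b (+) parity w 0 p.
have par_n : parity w 0 n.+2 = false.
  by rewrite [X in parity w 0 X]nE parity_mul // andbF.
have bitS b (p : 'I_n.+2) : bit b (p + 1) = bit b p (+) odd (w p).
  rewrite /bit -addbA; congr (_ (+) _).
  have [p1|p1] := ltnP p.+1 n.+2.
    have -> : (p + 1 : 'I_n.+2) = (p + 1)%N :> nat.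
      by rewrite /= modnDmr modn_small // addn1.
    by rewrite parityD add0r natr_Zp /= addbF.
  have pE : (p + 1)%N = n.+2.
    by apply/eqP; rewrite addn1 eqn_leq p1 (ltn_ord p).
  have -> : (p + 1 : 'I_n.+2) = 0%N :> nat by rewrite /= modnDmr pE modnn.
  have := parityD w 0 p 1; rewrite pE par_n add0r natr_Zp.
  by rewrite /= addbF.
have bit_h b (p : 'I_n.+2) : bit b (p + h%:R) = ~~ bit b p.
  have bit_add j : bit b (p + j%:R) = bit b p (+) parity w p j.
    elim: j => [|j IHj]; first by rewrite addr0 addbF.
    rewrite -natr1 addrA bitS IHj -[in RHS](addn1 j) parityD /= addbF addbA.
    by [].
  by rewrite bit_add -[X in parity w X h]natr_Zp parity_rot // odd_h addbT.
(* The order by this key is stable on tied pairs: it compares them by [bit]. *)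
pose key b (p : 'I_n.+2) := ((p %% h).*2 + bit b p)%N.
have bit_neq b (p q : 'I_n.+2) : p = q %[mod h] -> p != q -> bit b q = ~~ bit b p.
  move=> eq_mod /(distinct _ _ eq_mod)[]->; by rewrite bit_h ?negbK.
have key_lt b (p q : 'I_n.+2) :
    p = q %[mod h] -> p != q -> (key b p < key b q)%N = ~~ bit b p.
  move=> eq_mod neq_pq; rewrite /key eq_mod ltn_add2l (bit_neq _ p q) //.
  by case: (bit b p).
have key_inj b : injective (key b).
  move=> p q eq_key; apply/eqP/contraT => neq_pq.
  have eq_mod : p = q %[mod h].
    by move: eq_key; rewrite /key; case: (bit b p) (bit b q) => [] []; lia.
  have := key_lt b p q eq_mod neq_pq; rewrite eq_key ltnn => /esym/negbFE bit_p.
  have := key_lt b q p (esym eq_mod); rewrite eq_sym neq_pq eq_key ltnn.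
  by rewrite (bit_neq _ p q) // bit_p => /(_ isT).
have key_exists b : exists2 s, consistent w s & perm_lt s 0 h%:R = ~~ b.
  have [||s cs s_key] := @consistent_exists n w (fun p q => key b p < key b q)%N.
  - exact: strict_total_inj.
  - move=> p q t; have keyT := strict_total_inj (@key_inj b).
    have [->|neq_pq] := eqVneq p q.
      by have [-> _ _] := keyT; have [-> _ _] := lift_rel_total w keyT.
    have eq_mod (x y : 'I_n.+2) : tied w x y -> x = y %[mod h].
      by move/tied_mod; rewrite lE.
    rewrite lift_rel_neq ?(tied0 t) // !key_lt ?eq_addr1 //.
    + by rewrite bitS (tied0 t); case: (bit b p); case: odd.
    + exact: eq_mod (tied_shift 1 t).
    + exact: eq_mod.
  exists s => //; have t0 : tied w 0 h%:R by rewrite -[h%:R]add0r.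
  rewrite s_key // key_lt //; first by rewrite /bit /= addbF.
  by move/tied_mod: t0; rewrite lE.
rewrite -card_bool -(card_in_imset (f := fun s => perm_lt s 0 h%:R)).
  apply: eq_card => b; rewrite [RHS]inE; apply/imsetP.
  by have [s cs sE] := key_exists (~~ b); exists s; rewrite ?inE // sE negbK.
move=> s t; rewrite !inE => cs ct eq_st; apply: (consistent_uniq cs ct).
have agree (p : 'I_n.+2) : perm_lt s p (p + h%:R) = perm_lt t p (p + h%:R).
  have := eq_st; have th0 := tied_h 0; rewrite add0r in th0.
  rewrite (consistent_iter p cs neq0h th0) (consistent_iter p ct neq0h th0).
  by rewrite !add0r natr_Zp [_ + p]addrC => /addbI.
move=> p q neq_pq /tied_mod; rewrite lE => eq_mod.
have [->|pE] := distinct _ _ eq_mod neq_pq; first exact: agree.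
rewrite eq_sym in neq_pq.
rewrite (strict_total_asym (perm_lt_total s) neq_pq).
by rewrite (strict_total_asym (perm_lt_total t) neq_pq) pE agree.
Qed.

(** For a primitive word no two positions are tied, so the order is unique.  A
    consistent order of an [m]-th power with [m > 1] is reversed by the shift by
    [l], whose square must be trivial. *)
Lemma card_consistent n (w : 'I_n.+2 -> nat) (l := least_period w)
    (m := (n.+2 %/ l)%N) :
  #|[set s | consistent w s]| =
  (if m == 1 then 1 else if (m == 2) && parity w 0%R l then 2 else 0)%N.
Proof.
have l_gt0 : (0 < l)%N by apply: least_period_gt0.
have nE : n.+2 = (m * l)%N by rewrite divnK // least_period_dvd.
have wl : period w l by rewrite periodE.
case: eqP => [m1|m_neq1].
  have tied_eq p q : tied w p q -> p = q.
    move/tied_mod; rewrite -/l (_ : l = n.+2); last by rewrite nE m1 mul1n.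
    by rewrite !modn_small // => /val_inj.
  have [|p q /tied_eq<-|s cs _] :=
    @consistent_exists n w (fun p q : 'I_n.+2 => (p < q)%N).
  - exact/strict_total_inj/val_inj.
  - by rewrite /lift_rel !ltnn if_same andbF.
  rewrite (_ : [set _ | _] = [set s]) ?cards1 //.
  apply/setP => t; rewrite !inE; apply/idP/eqP => [ct|-> //].
  apply: consistent_uniq ct cs _ => p q neq_pq /tied_eq eq_pq.
  by rewrite eq_pq eqxx in neq_pq.
case: ifP => [/andP[/eqP m2 odd_l]|even_l].
  by apply: (@card_consistent_square _ _ l) => //; rewrite nE m2.
apply/eqP; rewrite cards_eq0; apply/set0Pn => -[s]; rewrite inE => cs.
have := consistent_square cs wl; rewrite {1}nE dvdn_pmul2r // => m_2.
have m2 : m = 2%N.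
  have := dvdn_leq (isT : (0 < 2)%N) m_2.
  by case: (m) m_neq1 m_2 => [|[|[|k]]] //.
rewrite m2 /= in even_l; rewrite (consistent_period cs wl) // in even_l.
by rewrite nE m2 gtnNdvd // mul2n -addnn; lia.
Qed.

(** * Counting fillings of cyclic permutations *)

(** The part of a word in the [d]-th power sum of the signed alphabet: it must be
    a [d]-th power, and an even [d] carries the sign of the root. *)
Definition root_weight n (w : 'I_n.+2 -> nat) (d : nat) : int :=
  if period w (n.+2 %/ d)
  then (if odd d then 1 else (-1) ^+ parity w 0 (n.+2 %/ d)) else 0.

(** With [n = m * l], [l] the least period, the divisors [d] that occur are those
    of [m]; then [sum_moebius_sign] applies. *)
Lemma card_consistent_moebius n (w : 'I_n.+2 -> nat) :
  #|[set s | consistent w s]|%:Z =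
  \sum_(d <- divisors n.+2) moebius d * root_weight w d.
Proof.
set l := least_period w; have l_gt0 : (0 < l)%N by apply: least_period_gt0.
have l_dvd : (l %| n.+2)%N by apply: least_period_dvd.
have m_gt0 : (0 < n.+2 %/ l)%N by rewrite divn_gt0 // dvdn_leq.
rewrite card_consistent -/l -natz -sum_moebius_sign //.
transitivity (\sum_(d <- divisors n.+2 | (l %| n.+2 %/ d)%N)
                 moebius d * root_weight w d); last first.
  rewrite big_mkcond; apply: eq_bigr => d _; rewrite /root_weight periodE -/l.
  by case: (l %| _)%N; rewrite ?mulr0.
have pm : perm_eq (divisors (n.+2 %/ l))
                  [seq d <- divisors n.+2 | (l %| n.+2 %/ d)%N].
  apply: uniq_perm; rewrite ?filter_uniq ?divisors_uniq // => d.
  rewrite mem_filter -!dvdn_divisors //.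
  apply/idP/andP => [dm|[ld dn]]; last first.
    by rewrite dvdn_divRL // mulnC -dvdn_divRL.
  have dn := dvdn_trans dm (dvdn_div l_dvd).
  by split=> //; rewrite dvdn_divRL // mulnC -dvdn_divRL.
rewrite (perm_big _ pm) big_filter big_seq_cond [RHS]big_seq_cond.
apply: eq_bigr => d /andP[]; rewrite -dvdn_divisors // => dn ld.
congr (_ * _); rewrite /root_weight periodE -/l ld; case: ifP => // _.
have eE : (n.+2 %/ d = n.+2 %/ l %/ d * l)%N.
  by rewrite -{1}(divnK ld) divnAC.
by rewrite eE parity_mul // periodE.
Qed.

Lemma sign_parity n (w : 'I_n.+2 -> nat) e :
  ((-1) ^+ parity w 0 e)%R = (\prod_(i < e) (-1) ^+ w i%:R)%R :> int.
Proof.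
elim: e => [|e IHe]; first by rewrite big_ord0.
rewrite big_ord_recr -IHe -[in LHS](addn1 e) parityD /= addbF add0r.
by rewrite signr_addb signr_odd.
Qed.

(** A word with period [e] is determined by its first [e] letters. *)
Lemma sum_periodic_words n M e (g : 'I_M -> int) : (0 < e)%N -> (e %| n.+2)%N ->
  \sum_(w : {ffun 'I_n.+2 -> 'I_M} | period (fun p => w p) e)
     \prod_(i < e) g (w i%:R) = (\sum_x g x) ^+ e.
Proof.
move=> e_gt0 e_dvd.
pose unroll (u : {ffun 'I_e -> 'I_M}) : {ffun 'I_n.+2 -> 'I_M} :=
  [ffun p : 'I_n.+2 => u (Ordinal (ltn_pmod p e_gt0))].
have modE (p : 'I_n.+2) i : nat_of_ord (p + i%:R)%R = (p + i)%N %[mod e].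
  by rewrite /= natr_ord modnDmr modn_dvdm.
have unrollE u (i : nat) (lt_i : (i < e)%N) : unroll u i%:R = u (Ordinal lt_i).
  rewrite ffunE; congr (u _); apply: val_inj.
  by rewrite /= natr_ord modn_dvdm // modn_small.
rewrite (reindex unroll).
  rewrite -[in RHS](card_ord e) -prodr_const bigA_distr_bigA /=.
  apply: eq_big => [u|u _].
    apply/periodP => p; rewrite !ffunE; congr (val (u _)); apply: val_inj.
    by rewrite [LHS]/= modE modnDr.
  apply: eq_bigr => i _; rewrite (unrollE u i (ltn_ord i)).
  by congr (g (u _)); apply: val_inj.
exists (fun w : {ffun 'I_n.+2 -> 'I_M} => [ffun i : 'I_e => w i%:R]).
  move=> u _; apply/ffunP => i; rewrite ffunE (unrollE u i (ltn_ord i)).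
  by congr (u _); apply: val_inj.
move=> w; rewrite inE => /(period_mul _) we; apply/ffunP => p.
rewrite !ffunE /=; apply: val_inj.
rewrite -[LHS](periodP _ _ (we (p %/ e)%N)) -natrD addnC -divn_eq.
by rewrite natr_Zp.
Qed.

(** The signs of [0 .. 2 k] alternate and start and end with [1]. *)
Lemma sum_letters k : (\sum_(x < k.*2.+1) (-1) ^+ x)%R = 1%R :> int.
Proof.
elim: k => [|k IHk]; first by rewrite big_ord_recr big_ord0.
by rewrite doubleS !big_ord_recr /= in IHk *; rewrite IHk /= !exprS; ring.
Qed.

Lemma sum_root_weight n k d : (0 < d)%N -> (d %| n.+2)%N ->
  \sum_(w : {ffun 'I_n.+2 -> 'I_(k.*2.+1)}) root_weight (fun p => w p) d =
  if odd d then (k.*2.+1 ^ (n.+2 %/ d))%N%:Z else 1.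
Proof.
move=> d_gt0 dn; have e_gt0 : (0 < n.+2 %/ d)%N by rewrite divn_gt0 // dvdn_leq.
have e_dvd := dvdn_div dn.
rewrite /root_weight -big_mkcond; case: odd.
  have := @sum_periodic_words n k.*2.+1 _ (fun=> 1) e_gt0 e_dvd.
  rewrite [in RHS]sumr_const card_ord -natrX natz => <-.
  by apply: eq_bigr => w _; rewrite big1.
have := @sum_periodic_words n k.*2.+1 _ (fun x => (-1) ^+ x) e_gt0 e_dvd.
rewrite sum_letters expr1n => sum1; rewrite -[RHS]sum1.
by apply: eq_bigr => w _; rewrite sign_parity.
Qed.

(** Strict total orders are equal once one is contained in the other, so the
    one-sided condition on a filling is an equality of orders. *)
Lemma compatible_conj n M (s : 'S_n.+2) (f : {ffun 'I_n.+2 -> 'I_M}) :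
  compatible (rotation n ^ s)%g f = consistent (fun p => f (s p)) s.
Proof.
have fillE p q : filling_lt (rotation n ^ s)%g f (s p) (s q) =
                 lift_rel (fun p => f (s p)) (perm_lt s) p q.
  by rewrite /filling_lt /lift_rel !permJ !permE.
apply/forallP/consistentP => [h|cs i].
  apply: strict_total_eq (perm_lt_total s) (lift_rel_total _ (perm_lt_total s)) _.
  move=> p q lt_pq; rewrite -fillE.
  by have /forallP/(_ (s q))/implyP := h (s p); apply.
apply/forallP => j; apply/implyP; rewrite -(permKV s i) -(permKV s j) => lt_ij.
by rewrite fillE -cs.
Qed.

(** Sum over the [n] conjugators of each cycle, exchange the sums over permutations
    and over words, and collect the even divisors. *)
Lemma sum_compatible_cyclic n k :
  (n.+2 * \sum_(u : 'S_n.+2 | cyclic_perm u)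
     #|[set f : {ffun 'I_n.+2 -> 'I_(k.*2.+1)} | compatible u f]|)%N%:Z =
  \sum_(d <- divisors n.+2 | odd d)
     moebius d * (k.*2.+1 ^ (n.+2 %/ d))%N%:Z
  - (n.+2`_2^' == 1)%N%:R.
Proof.
rewrite -(sum_conj_rotation (fun u =>
  #|[set f : {ffun 'I_n.+2 -> 'I_(k.*2.+1)} | compatible u f]|)).
transitivity (\sum_(w : {ffun 'I_n.+2 -> 'I_(k.*2.+1)})
    #|[set s | consistent (fun p => w p) s]|%:Z).
  rewrite -natz natr_sum.
  transitivity (\sum_(s : 'S_n.+2) \sum_(w : {ffun 'I_n.+2 -> 'I_(k.*2.+1)})
      (consistent (fun p => w p) s)%:R : int).
    apply: eq_bigr => s _; rewrite -sum1_card natr_sum big_mkcond.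
    rewrite [RHS](reindex (fun f : {ffun 'I_n.+2 -> 'I_(k.*2.+1)} =>
                             [ffun p => f (s p)])) /=.
      apply: eq_bigr => f _; rewrite inE compatible_conj.
      rewrite (_ : consistent _ s = consistent (fun p => [ffun p => f (s p)] p) s).
        by case: consistent.
      by apply/consistentP/consistentP => h p q; rewrite h /lift_rel !ffunE.
    exists (fun f : {ffun 'I_n.+2 -> 'I_(k.*2.+1)} => [ffun p => f (s^-1 p)%g]) => f _;
      apply/ffunP => p; by rewrite !ffunE ?permK ?permKV.
  rewrite exchange_big; apply: eq_bigr => w _.
  rewrite -natz -sum1_card natr_sum [RHS]big_mkcond; apply: eq_bigr => s _.
  by rewrite inE; case: consistent.
under eq_bigr do rewrite card_consistent_moebius.
rewrite exchange_big.
transitivity (\sum_(d <- divisors n.+2) moebius d *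
    (if odd d then (k.*2.+1 ^ (n.+2 %/ d))%N%:Z else 1)).
  rewrite big_seq [RHS]big_seq; apply: eq_bigr => d; rewrite -dvdn_divisors // => dn.
  by rewrite -mulr_sumr sum_root_weight // (dvdn_gt0 _ dn).
rewrite (bigID odd) /=; congr (_ + _).
  by apply: eq_bigr => d ->.
rewrite -sum_moebius_even //; apply: eq_bigr => d /negPf->.
by rewrite mulr1.
Qed.

(** * The generating polynomial of left peaks over cyclic permutations *)

Lemma is_gf_typeB n d : (0 < d)%N -> (d %| n)%N ->
  is_gf n.+1 (fun k => (k.*2.+1 ^ (n %/ d))%N%:Z)
    ((1 - 'X) ^+ (n - n %/ d) * typeB_eulerian (n %/ d)).
Proof.
move=> d_gt0 dn; have := is_gf_widen (n - n %/ d) (@typeB_eulerianP (n %/ d)).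
rewrite addSn subnKC ?leq_div //; apply: eq_is_gf => k.
by rewrite mul2n addn1.
Qed.

Lemma cyclic_lpk_poly n :
  n.+2%:R * \sum_(u : 'S_n.+2 | cyclic_perm u)
     (4 *: 'X) ^+ lpk u * (1 + 'X) ^+ (n.+2 - (lpk u).*2) =
  \sum_(d <- divisors n.+2 | odd d)
     moebius d *: ((1 - 'X) ^+ (n.+2 - n.+2 %/ d) * typeB_eulerian (n.+2 %/ d))
  - (n.+2`_2^' == 1)%N%:R *: (1 - 'X) ^+ n.+2 :> {poly int}.
Proof.
set f := fun k => (n.+2 * \sum_(u : 'S_n.+2 | cyclic_perm u)
  #|[set f : {ffun 'I_n.+2 -> 'I_(k.*2.+1)} | compatible u f]|)%N%:Z.
(* Both sides are the numerator of the generating function of [f]. *)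
apply: (@is_gf_uniq n.+3 f).
  rewrite mulr_natl -scaler_nat.
  have gf_sum := @is_gf_sum n.+3 _ (index_enum {perm 'I_n.+2}) (@cyclic_perm n.+2)
    _ _ (fun u _ _ => is_gf_compatible u).
  apply: eq_is_gf (is_gfZ _ gf_sum) => k.
  rewrite /f -natz natrM natr_sum; congr (_ * _).
  by apply: eq_bigr => u _; rewrite natz.
apply: eq_is_gf (fun k => esym (sum_compatible_cyclic n k)) _.
rewrite -scaleNr; apply: is_gfD.
  apply: is_gf_sum => d; rewrite -dvdn_divisors // => dn _.
  by apply/is_gfZ/is_gf_typeB => //; apply: dvdn_gt0 dn.
have := is_gfZ (- (n.+2`_2^' == 1)%N%:R) (is_gf_widen n.+2 is_gf_const).
by rewrite !mulr1 add1n.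
Qed.

(** * Evaluation in a field *)

Lemma leq_lpk n (s : 'S_n.+1) : ((lpk s).*2 <= n.+1)%N.
Proof.
by have := leq_peaks false (descents s); rewrite -lpk_peaks size_mkseq addn0.
Qed.

Definition eval_int (F : fieldType) (x : F) (p : {poly int}) : F :=
  (map_poly intr p).[x].

(** The morphism structure through which sums and products pass [eval_int]. *)
Lemma eval_intE (F : fieldType) (x : F) :
  {f : {rmorphism {poly int} -> F} | f =1 eval_int x}.
Proof. by exists (horner_eval x \o map_poly intr). Qed.

Lemma eval_cyc_lpk (F : fieldType) (t : F) n :
  1 + t != 0 -> n.+2%:R != 0 :> F ->
  eval_int (4 * t / (1 + t) ^+ 2) (cyc_lpk n.+2) =
  (\sum_(d <- divisors n.+2 | odd d)
     (moebius d)%:~R * (1 - t) ^+ (n.+2 - n.+2 %/ d)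
     * eval_int t (typeB_eulerian (n.+2 %/ d))
   - (n.+2`_2^' == 1)%N%:R * (1 - t) ^+ n.+2) / (n.+2%:R * (1 + t) ^+ n.+2).
Proof.
move=> t1 n0; have [ev evE] := eval_intE t.
have evX : ev 'X = t by rewrite evE /eval_int map_polyX hornerX.
have evZ c p : ev (c *: p) = c%:~R * ev p.
  by rewrite -mul_polyC rmorphM /= [ev c%:P]evE /eval_int map_polyC hornerC.
apply: (canRL (mulfK _)); first by rewrite mulf_neq0 ?expf_neq0.
have := congr1 ev (cyclic_lpk_poly n).
rewrite rmorphB rmorph_sum evZ rmorphXn rmorphB rmorph1 evX /=.
under eq_bigr => d _.
  rewrite evZ rmorphM rmorphXn rmorphB rmorph1 evX /= mulrA evE; over.
rewrite rmorph_nat => <-.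
rewrite rmorphM rmorph_nat rmorph_sum mulrCA; congr (_ * _).
have [ex exE] := eval_intE (4 * t / (1 + t) ^+ 2).
rewrite -exE rmorph_sum mulr_suml; apply: eq_bigr => u _ /=.
rewrite rmorphXn /= [ex 'X]exE /eval_int map_polyX hornerX.
rewrite rmorphM !rmorphXn rmorphD rmorph1 evZ evX /= expr_div_n -exprM mul2n.
have -> : (1 + t) ^+ n.+2 =
    (1 + t) ^+ (lpk u).*2 * (1 + t) ^+ (n.+2 - (lpk u).*2).
  by rewrite -exprD subnKC ?leq_lpk.
by rewrite mulrA divfK // expf_neq0.
Qed.

(** The contribution of the even divisors survives only for powers of two, whose
    only odd divisor is [1]. *)
Lemma cyc_lpk_formula (F : fieldType) (t : F) (n : nat) :
  (2 <= n)%N -> 1 + t != 0 -> n%:R != 0 :> F ->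
  ((exists k : nat, n = (2 ^ k)%N) ->
     eval_int (4 * t / (1 + t) ^+ 2) (cyc_lpk n) =
     (eval_int t (typeB_eulerian n) - (1 - t) ^+ n) / (n%:R * (1 + t) ^+ n)) /\
  (~ (exists k : nat, n = (2 ^ k)%N) ->
     eval_int (4 * t / (1 + t) ^+ 2) (cyc_lpk n) =
     1 / (n%:R * (1 + t) ^+ n) *
     \sum_(d <- divisors n | odd d)
        (moebius d)%:~R * (1 - t) ^+ (n - n %/ d)
        * eval_int t (typeB_eulerian (n %/ d))).
Proof.
case: n => [|[|n]] // _ t1 n0; rewrite eval_cyc_lpk //.
have n2P := @partn_2'_eq1 n.+2 isT; split=> [/n2P n2|n2].
  rewrite n2 mul1r; congr ((_ - _) / _); rewrite big_mkcond.
  rewrite (bigD1_seq 1%N) ?divisors_uniq -?dvdn_divisors //= big1_seq ?addr0.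
    by rewrite moebius1 divn1 subnn expr0 !mul1r.
  move=> d /andP[d_neq1]; rewrite -dvdn_divisors // => dn.
  case: ifP => // d_odd; case/eqP: d_neq1; apply/eqP.
  rewrite -dvdn1 -(eqP n2) -(@part_pnat_id (2%N)^' d) -?odd_2'nat //.
  exact: partn_dvd.
case n2E: (n.+2`_2^' == 1)%N; first by case: n2; apply/n2P.
by rewrite mul0r subr0 mulrC mul1r.
Qed.

Lemma one_plus_tvar_neq0 : 1 + tvar != 0.
Proof.
rewrite /tvar -tofrac1 -tofracD tofrac_eq0 addrC.
by rewrite -polyC1 -size_poly_eq0 size_XaddC.
Qed.

Lemma natr_ratfun_neq0 n : (0 < n)%N -> n%:R != 0 :> ratfun.
Proof.
move=> n_gt0; rewrite -[n%:R]/(1 *+ n) -tofrac1 -tofracMn tofrac_eq0.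
by rewrite -polyC1 -polyCMn polyC_eq0 Num.Theory.pnatr_eq0 -lt0n.
Qed.

Theorem theorem4p7 (n : nat) (hn : (2 <= n)%N) :
  let t := tvar in
  ((exists k : nat, n = (2 ^ k)%N) ->
     eval_at (cyc_lpk n) (4 * t / (1 + t) ^+ 2) =
     (eval_at (typeB_eulerian n) t - (1 - t) ^+ n) / (n%:R * (1 + t) ^+ n)) /\
  (~ (exists k : nat, n = (2 ^ k)%N) ->
     eval_at (cyc_lpk n) (4 * t / (1 + t) ^+ 2) =
     1 / (n%:R * (1 + t) ^+ n) *
     \sum_(d <- divisors n | odd d)
        (moebius d)%:~R * (1 - t) ^+ (n - n %/ d)
        * eval_at (typeB_eulerian (n %/ d)) t).
Proof.
have n_neq0 := natr_ratfun_neq0 (ltnW hn).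
exact: (cyc_lpk_formula hn one_plus_tvar_neq0 n_neq0).
Qed.
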